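(* Let $u=(u_{ij}^n)$ be the solution provided by the three-level explicit time-split MacCormack scheme described in the context, with time step $k$ and mesh size $h$. Under the time step restriction $\frac{2ak}{h^2}\le 1$, the following estimate holds: $$\max_{0\le n\le N}\|u^n\|_{L^2(\Omega)}\le \widetilde{C}+\exp\left(CT\sum_{l=0}^{3}(Ck)^l\right),$$ where $C$ is a positive constant independent of the time step $k$ and the mesh size $h$, and $\widetilde{C}$ is the constant (given in the context) bounding the norms of the exact solution $\overline{u}$.
   Context: Problem. Let $\Omega=(0,1)^2$, $T>0$, $a>0$ the diffusive coefficient, and $f\in\mathcal{C}^1(\mathbb{R})$ a Lipschitz function. Consider $$u_t-a\Delta u=f(u)\ \text{ for }(x,y)\in\Omega,\ t\in(0,T];\qquad u(x,y,0)=u_0(x,y)\ \text{ on }\overline{\Omega};\qquad u(x,y,t)=\varphi(x,y,t)\ \text{ for }(x,y)\in\partial\Omega,\ t\in(0,T].$$ The data $u_0,\varphi$ are assumed regular enough and satisfy $\varphi(x,y,0)=u_0(x,y)$ on $\partial\Omega$, so that the problem admits a smooth (exact) solution $\overline{u}$. Grid. $N,M$ are positive integers, $k=T/N$, $h=1/M$, $t^n=nk$, $x_i=ih$, $y_j=jh$ ($0\le i,j\le M$), $\varphi_{ij}^n=\varphi(x_i,y_j,t^n)$, $\overline{u}_{ij}^n=\overline{u}(x_i,y_j,t^n)$. Scheme. $u_{ij}^0=u_0(x_i,y_j)$ for $0\le i,j\le M$, and for $n=0,1,\dots,N-1$, for $1\le i,j\le M-1$, $$u_{ij}^{*}=u^{n}_{ij}+\tfrac{k}{2}\left(\tfrac{a}{h^{2}}(u^{n}_{i,j+1}-2u^{n}_{ij}+u^{n}_{i,j-1})+f(u_{ij}^{n})\right),$$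 $$u_{ij}^{**}=u^{*}_{ij}+\tfrac{ak}{h^{2}}(u^{*}_{i+1,j}-2u^{*}_{ij}+u^{*}_{i-1,j}),$$ $$u_{ij}^{n+1}=u^{**}_{ij}+\tfrac{k}{2}\left(\tfrac{a}{h^{2}}(u^{**}_{i,j+1}-2u^{**}_{ij}+u^{**}_{i,j-1})+f(u_{ij}^{**})\right).$$ At boundary nodes ($i\in\{0,M\}$ or $j\in\{0,M\}$): $u_{ij}^n=\varphi_{ij}^n$ for all $0\le n\le N$, and, within the step from $t^n$ to $t^{n+1}$, $u_{ij}^*=u_{ij}^{**}=\varphi_{ij}^{n+1}$. Norms. $\|w^n\|_{L^2(\Omega)}=h\left(\sum_{i,j=1}^{M-1}|w_{ij}^n|^2\right)^{1/2}$ (discrete $L^2$ norm of a grid function), and $\||w|\|_{L^\infty(0,T;L^2(\Omega))}=\max_{0\le n\le N}\|w^n\|_{L^2(\Omega)}$. Standing regularity assumption. $\overline{u}\in L^{\infty}(0,T;L^{2}(\Omega))\cap H^{1}(0,T;H^{3}(\Omega))\cap H^{2}(0,T;H^{1}(\Omega))\cap H^{2}(0,T;L^{2}(\Omega))\cap L^{2}(0,T;H^{4}(\Omega))$, and $\widetilde{C}$ is a positive constant independent of $k$ and $h$ with $$\||\overline{u}|\|_{L^{\infty}(0,T;L^{2}(\Omega))}+\||\overline{u}|\|_{H^{1}(0,T;H^{3}(\Omega))}+\||\overline{u}|\|_{H^{2}(0,T;H^{1}(\Omega))}+\||\overline{u}|\|_{H^{2}(0,T;L^{2}(\Omega))}+\||\overline{u}|\|_{L^{2}(0,T;H^{4}(\Omega))}\le\widetilde{C}.$$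 *)

(* Defs.v *)
From HB Require Import structures.
From mathcomp Require Import all_boot all_order all_algebra.
From mathcomp Require Import all_classical all_reals all_analysis.

Set Implicit Arguments.
Unset Strict Implicit.
Unset Printing Implicit Defensive.

Import Order.TTheory GRing.Theory Num.Theory.
Import numFieldNormedType.Exports.

Local Open Scope classical_set_scope.
Local Open Scope ring_scope.

(* Points of space-time are written ((x, y), t), i.e. (x, y, t); points of the
   plane are written (x, y).  Data that the problem prescribes only on part of
   space(-time) are total functions; only their values there are ever used. *)

Section Domains.
Context {R : realType}.

Definition Omega : set (R * R) :=
  [set p | (0 < p.1 < 1) && (0 < p.2 < 1)].

Definition cl_Omega : set (R * R) :=
  [set p | (0 <= p.1 <= 1) && (0 <= p.2 <= 1)].

Definition bd_Omega : set (R * R) := cl_Omega `\` Omega.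

(* Omega x (0, T) *)
Definition cylinder (T : R) : set (R * R * R) :=
  Omega `*` [set t | 0 < t < T].

(* Omega x (0, T], where the equation holds *)
Definition parabolic_cylinder (T : R) : set (R * R * R) :=
  Omega `*` [set t | 0 < t <= T].

(* closure of Omega x (0, T) *)
Definition cl_cylinder (T : R) : set (R * R * R) :=
  cl_Omega `*` [set t | 0 <= t <= T].

Definition e_x : R * R * R := (1, 0, 0).
Definition e_y : R * R * R := (0, 1, 0).
Definition e_t : R * R * R := (0, 0, 1).

End Domains.

Definition C1 {R : realType} (f : R -> R) : Prop :=
  (forall x, derivable f x 1) /\ continuous (derive1 f).

Section ExactSolution.
Context {R : realType}.

(* v is the time derivative of u at z, relatively to times at most T: this is
   the ordinary partial derivative if z.2 < T, and the left derivative at the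
   final time z.2 = T. *)
Definition is_time_derivative (T : R) (u : R * R * R -> R) (z : R * R * R)
    (v : R) : Prop :=
  (fun s => (u (z.1, s) - u z) / (s - z.2)) @ within [set s | s <= T] (z.2)^'
    --> v.

(* Classical solution of u_t - a (u_xx + u_yy) = f(u) with initial data u0 and
   lateral Dirichlet data phi. *)
Definition exact_solution (T a : R) (f : R -> R) (u0 : R * R -> R)
    (phi u : R * R * R -> R) : Prop :=
  [/\ {within cl_cylinder T, continuous u},
      exists ut ux uy uxx uyy : R * R * R -> R,
        [/\ [/\ {within parabolic_cylinder T, continuous ut},
                {within parabolic_cylinder T, continuous ux},
                {within parabolic_cylinder T, continuous uy},
                {within parabolic_cylinder T, continuous uxx} &
                {within parabolic_cylinder T, continuous uyy}],
            forall z, parabolic_cylinder T z ->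
              [/\ is_time_derivative T u z (ut z),
                  is_derive z e_x u (ux z), is_derive z e_y u (uy z),
                  is_derive z e_x ux (uxx z) & is_derive z e_y uy (uyy z)] &
            forall z, parabolic_cylinder T z ->
              ut z - a * (uxx z + uyy z) = f (u z)],
      forall p, cl_Omega p -> u (p, 0) = u0 p &
      forall p t, bd_Omega p -> 0 < t <= T -> u (p, t) = phi (p, t)].

End ExactSolution.

Section SobolevNorms.
Context {R : realType}.

(* R with the Borel sigma-algebra carried by lebesgue_measure *)
Local Notation mR := (measurableTypeR R).

(* Lebesgue measure on space-time *)
Definition leb3 : {measure set (mR * mR * mR) -> \bar R} :=
  (@lebesgue_measure R \x @lebesgue_measure R \x @lebesgue_measure R)%E.

Definition pderiv (v : R * R * R) (g : R * R * R -> R) : R * R * R -> R :=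
  fun z => 'D_v g z.

(* d_t^l d_x^p d_y^q *)
Definition mixed_pderiv (l p q : nat) (g : R * R * R -> R) :
    R * R * R -> R :=
  iter l (pderiv e_t) (iter p (pderiv e_x) (iter q (pderiv e_y) g)).

Definition test_function (Q : set (R * R * R)) (g : R * R * R -> R) : Prop :=
  (forall (vs : seq (R * R * R)) z, differentiable (foldr pderiv g vs) z) /\
  exists K, [/\ compact K, K `<=` Q & forall z, ~ K z -> g z = 0].

(* g is the weak derivative d_t^l d_x^p d_y^q u on the open set Q *)
Definition weak_derivative (Q : set (R * R * R)) (l p q : nat)
    (u g : R * R * R -> R) : Prop :=
  [/\ measurable_fun (Q : set (mR * mR * mR)) g,
      forall K, compact K -> K `<=` Q -> leb3.-integrable K (EFin \o g) &
      forall psi, test_function Q psi ->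
        (\int[leb3]_(z in Q) (u z * mixed_pderiv l p q psi z)%:E =
         ((-1) ^+ (l + p + q))%:E * \int[leb3]_(z in Q) (g z * psi z)%:E)%E].

(* Squared L^2(Q) norm of the weak derivative d_t^l d_x^p d_y^q u.  All weak
   derivatives of u agree a.e., so this is an infimum over a single value; it
   is +oo if there is no weak derivative. *)
Definition weak_derivative_norm2 (Q : set (R * R * R)) (l p q : nat)
    (u : R * R * R -> R) : \bar R :=
  ereal_inf [set (\int[leb3]_(z in Q) ((g z) ^+ 2)%:E)%E |
             g in [set g | weak_derivative Q l p q u g]].

(* Norm of the Bochner-Sobolev space H^s(0, T; H^r(Omega)); it is finite
   exactly on that space.  H^0 is L^2. *)
Definition bochner_sobolev_norm (T : R) (s r : nat) (u : R * R * R -> R) :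
    \bar R :=
  sqrte (\sum_(l < s.+1) \sum_(p < r.+1) \sum_(q < r.+1 | (p + q <= r)%N)
           weak_derivative_norm2 (cylinder T) l p q u)%E.

End SobolevNorms.

Section Scheme.
Context {R : realType}.
Implicit Types (w : nat -> nat -> R) (u : nat -> nat -> nat -> R).

Definition tstep (T : R) (N : nat) : R := T / N%:R.
Definition mesh (M : nat) : R := M%:R^-1.

Definition gridpt (M i j : nat) : R * R :=
  (i%:R * mesh M, j%:R * mesh M).

Definition interior_node (M i j : nat) : bool :=
  (0 < i < M)%N && (0 < j < M)%N.

Definition boundary_node (M i j : nat) : bool :=
  [&& (i <= M)%N, (j <= M)%N & ~~ interior_node M i j].

Definition d2x (M : nat) w (i j : nat) : R :=
  (w i.+1 j - w i j *+ 2 + w i.-1 j) / mesh M ^+ 2.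

Definition d2y (M : nat) w (i j : nat) : R :=
  (w i j.+1 - w i j *+ 2 + w i j.-1) / mesh M ^+ 2.

(* us n and uss n are the intermediate levels u^* and u^** of the step from
   t^n to t^{n+1}. *)
Definition maccormack_solution (T a : R) (f : R -> R) (u0 : R * R -> R)
    (phi : R * R * R -> R) (N M : nat) u : Prop :=
  let k := tstep T N in
  exists us uss : nat -> nat -> nat -> R,
  [/\ forall i j, (i <= M)%N -> (j <= M)%N -> u 0 i j = u0 (gridpt M i j),
      forall n i j, (n < N)%N -> interior_node M i j ->
        [/\ us n i j = u n i j + k / 2 * (a * d2y M (u n) i j + f (u n i j)),
            uss n i j = us n i j + k * (a * d2x M (us n) i j) &
            u n.+1 i j = uss n i j
              + k / 2 * (a * d2y M (uss n) i j + f (uss n i j))],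
      forall n i j, (n <= N)%N -> boundary_node M i j ->
        u n i j = phi (gridpt M i j, n%:R * k) &
      forall n i j, (n < N)%N -> boundary_node M i j ->
        us n i j = phi (gridpt M i j, n.+1%:R * k) /\
        uss n i j = phi (gridpt M i j, n.+1%:R * k)].

Definition grid_l2 (M : nat) w : R :=
  mesh M * Num.sqrt (\sum_(1 <= i < M) \sum_(1 <= j < M) `|w i j| ^+ 2).

(* max over 0 <= n <= N; the norms are nonnegative *)
Definition grid_linfty_l2 (N M : nat) u : R :=
  \big[Num.max/0]_(n < N.+1) grid_l2 M (u n).

Definition restrict_grid (T : R) (N M : nat) (v : R * R * R -> R) :
    nat -> nat -> nat -> R :=
  fun n i j => v (gridpt M i j, n%:R * tstep T N).

End Scheme.

(* The L^oo(0, T; L^2) norm is the discrete one, so the bound is required, with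
   the same constant, on every grid. *)
Definition regularity_bound {R : realType} (T : R) (u : R * R * R -> R)
    (Ct : R) : Prop :=
  forall N M : nat, (0 < N)%N -> (0 < M)%N ->
    ((grid_linfty_l2 N M (restrict_grid T N M u))%:E
     + bochner_sobolev_norm T 1 3 u
     + bochner_sobolev_norm T 2 1 u
     + bochner_sobolev_norm T 2 0 u
     + bochner_sobolev_norm T 0 4 u <= Ct%:E)%E.

(* Main.v *)
Require Import Defs.
From mathcomp Require Import all_boot all_order all_algebra.
From mathcomp Require Import all_classical all_reals all_analysis.
From mathcomp Require Import ring lra.

(** Only the order of magnitude of the numerical solution is asserted: since
    the sum over [l] contains the term [1], it is enough to bound the grid
    functions [u^n] uniformly in the grid and to choose [C] such that
    [exp (C T)] is that bound; the other terms are nonnegative.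

    The bound comes from a discrete maximum principle.  The restriction
    [2 a k / h^2 <= 1] makes every one-dimensional diffusion sweep a convex
    combination of neighbouring values ([diffusion_sweep_le]), so that a sweep
    does not increase the maximum norm.  Only the two reaction terms can, and a
    Lipschitz [f] grows at most linearly, [|f v| <= K (1 + |v|)]
    ([lipschitz_linear_growth]).  Hence [1 + |u|] is multiplied by at most
    [(1 + k K / 2)^2] per time step ([maccormack_max_bound]), and by at most
    [exp (K T)] over the whole time interval ([compound_growth_le_expR]).

    The initial and boundary values are values of the exact solution on the
    closed space-time cylinder, where it is bounded by compactness
    ([exact_solution_bounded]).  Finally the discrete [L^2] norm is dominated by
    the maximum norm because the square has area one ([grid_l2_le]). *)

Import Order.TTheory GRing.Theory Num.Theory.
Import numFieldNormedType.Exports.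

Local Open Scope ring_scope.

(** * One-dimensional sweeps *)

(** With [r = c a / d], the new value is
    [(1 - 2 r) v + r v1 + r v2]; the condition [2 r <= 1] makes all three
    weights nonnegative. *)
Lemma diffusion_sweep_le (R : realFieldType) (c a d m v v1 v2 : R) :
  0 <= c * a / d -> 2 * (c * a / d) <= 1 ->
  `|v| <= m -> `|v1| <= m -> `|v2| <= m ->
  `|v + c * (a * ((v1 - v *+ 2 + v2) / d))| <= m.
Proof.
set r := c * a / d => r_ge0 r_le.
have -> : v + c * (a * ((v1 - v *+ 2 + v2) / d)) =
          (1 - 2 * r) * v + r * v1 + r * v2 by rewrite /r; ring.
rewrite !ler_norml => /andP[? ?] /andP[? ?] /andP[? ?].
by apply/andP; split; nra.
Qed.

Lemma reaction_diffusion_sweep_le (R : realFieldType) (f : R -> R)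
    (K c a d m v v1 v2 : R) :
  (forall x, `|f x| <= K * (1 + `|x|)) -> 0 <= K -> 0 <= c ->
  0 <= c * a / d -> 2 * (c * a / d) <= 1 ->
  1 + `|v| <= m -> 1 + `|v1| <= m -> 1 + `|v2| <= m ->
  1 + `|v + c * (a * ((v1 - v *+ 2 + v2) / d) + f v)| <= m * (1 + c * K).
Proof.
move=> fK K_ge0 c_ge0 r_ge0 r_le hv hv1 hv2.
have diff : `|v + c * (a * ((v1 - v *+ 2 + v2) / d))| <= m - 1.
  by apply: diffusion_sweep_le => //; rewrite lerBrDl.
have reac : `|c * f v| <= c * (K * m).
  rewrite normrM (ger0_norm c_ge0) ler_wpM2l// (le_trans (fK v))//.
  by rewrite ler_wpM2l.
rewrite mulrDr addrA (le_trans (lerD (lexx 1) (ler_normD _ _)))//.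
have -> : m * (1 + c * K) = 1 + ((m - 1) + c * (K * m)) by ring.
by rewrite lerD2l lerD.
Qed.

(** * Growth of the data *)

Lemma lipschitz_linear_growth {R : realType} {f : R -> R} : lipschitz f ->
  exists2 K, 0 < K & forall x, `|f x| <= K * (1 + `|x|).
Proof.
move=> /pinfty_ex_gt0[L L_gt0 fL].
exists (L + `|f 0|); first by rewrite ltr_wpDr.
move=> x.
have dist : `|f x - f 0| <= L * `|x - 0| by apply: (fL (x, 0)).
rewrite subr0 in dist.
have tri : `|f x| <= `|f x - f 0| + `|f 0|.
  by rewrite -[X in `|X| <= _](subrK (f 0)) ler_normD.
have := mulr_ge0 (normr_ge0 (f 0)) (normr_ge0 x).
have := normr_ge0 (f 0).
nra.
Qed.

Lemma compound_growth_le_expR (R : realType) (N n : nat) (K T : R) :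
  0 <= K -> 0 <= T -> (0 < N)%N -> (n <= N)%N ->
  ((1 + tstep T N / 2 * K) ^+ 2) ^+ n <= expR (K * T).
Proof.
move=> K_ge0 T_ge0 N_gt0 leqnN; rewrite -exprM.
have kK_ge0 : 0 <= tstep T N / 2 * K.
  by rewrite mulr_ge0// divr_ge0// divr_ge0// ler0n.
apply: (@le_trans _ _ (expR (tstep T N / 2 * K) ^+ (2 * n))).
  by rewrite lerXn2r ?nnegrE ?addr_ge0 ?expR_ge0 ?expR_ge1Dx.
rewrite -expRM_natl ler_expR.
have -> : (2 * n)%:R * (tstep T N / 2 * K) = K * T * (n%:R / N%:R).
  rewrite /tstep natrM; field.
  by rewrite pnatr_eq0 -lt0n.
rewrite ler_piMr ?mulr_ge0// ler_pdivrMr ?ltr0n// mul1r.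
by rewrite ler_nat.
Qed.

Lemma compact_cl_cylinder (R : realType) (T : R) : compact (cl_cylinder T).
Proof.
have itvE (b : R) : [set t | 0 <= t <= b]%classic = `[0, b]%classic.
  by apply/seteqP; split => t /=; rewrite in_itv.
apply: compact_setX; last by rewrite itvE; exact: segment_compact.
have -> : @cl_Omega R = (`[0, 1] `*` `[0, 1])%classic.
  by apply/seteqP; split => -[x y] /=; rewrite !in_itv /= => /andP.
by apply: compact_setX; exact: segment_compact.
Qed.

Lemma exact_solution_bounded {R : realType} {T a : R} {f : R -> R}
    {u0 : R * R -> R} {phi u : R * R * R -> R} :
  exact_solution T a f u0 phi u ->
  exists2 B, 0 < B & forall z, cl_cylinder T z -> `|u z| <= B.
Proof.
move=> [u_cont _ _ _].
have /compact_bounded/pinfty_ex_gt0[B B_gt0 uB] :=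
  continuous_compact u_cont (@compact_cl_cylinder R T).
by exists B => // z Tz; apply: uB; exists z.
Qed.

(** * Grid nodes *)

Lemma gridpt_cl_Omega (R : realType) (M i j : nat) :
  (0 < M)%N -> (i <= M)%N -> (j <= M)%N -> cl_Omega (gridpt M i j : R * R).
Proof.
move=> M_gt0 iM jM.
have coord l : (l <= M)%N -> 0 <= (l%:R * mesh M : R) <= 1.
  move=> lM; rewrite mulr_ge0 ?invr_ge0 ?ler0n//=.
  by rewrite ler_pdivrMr ?ltr0n// mul1r ler_nat.
by rewrite /cl_Omega /= !coord.
Qed.

Lemma boundary_node_bd_Omega (R : realType) (M i j : nat) :
  (0 < M)%N -> boundary_node M i j -> bd_Omega (gridpt M i j : R * R).
Proof.
move=> M_gt0 /and3P[iM jM /negP nint]; split; first exact: gridpt_cl_Omega.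
have coord l : 0 < (l%:R * mesh M : R) < 1 -> (0 < l < M)%N.
  rewrite pmulr_lgt0 ?invr_gt0 ?ltr0n// => /andP[->] /=.
  by rewrite ltr_pdivrMr ?ltr0n// mul1r ltr_nat.
by move=> /andP[/coord hi /coord hj]; apply: nint; rewrite /interior_node hi hj.
Qed.

(** The square has [(M - 1)^2] interior nodes, each of weight [h^2 = M^-2], so the
    total weight is at most one. *)
Lemma grid_l2_le (R : realType) (M : nat) (w : nat -> nat -> R) (m : R) :
  (0 < M)%N -> 0 <= m ->
  (forall i j, (i <= M)%N -> (j <= M)%N -> `|w i j| <= m) ->
  grid_l2 M w <= m.
Proof.
move=> M_gt0 m_ge0 wm.
have M_gt0' : 0 < M%:R :> R by rewrite ltr0n.
rewrite /grid_l2 /mesh mulrC ler_pdivrMr//.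
have mM_ge0 : 0 <= m * M%:R by rewrite mulr_ge0// ltW.
rewrite -[leRHS](ger0_norm mM_ge0) -sqrtr_sqr ler_wsqrtr//.
have sum_const (c : R) : 0 <= c -> \sum_(1 <= i < M) c <= c * M%:R.
  move=> c_ge0; rewrite sumr_const_nat -[leLHS]mulr_natr ler_wpM2l// ler_nat.
  exact: leq_subr.
apply: (@le_trans _ _ (\sum_(1 <= i < M) (m ^+ 2 * M%:R))).
  apply: ler_sum_nat => i /andP[_ /ltnW iM].
  apply: le_trans (sum_const _ (sqr_ge0 m)).
  apply: ler_sum_nat => j /andP[_ /ltnW jM].
  by rewrite lerXn2r ?nnegrE// wm.
have -> : (m * M%:R) ^+ 2 = m ^+ 2 * M%:R * M%:R by ring.
by rewrite sum_const// mulr_ge0 ?sqr_ge0// ltW.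
Qed.

(** * Stability of the scheme in the maximum norm *)

(** A property of all grid values may be checked separately at the nodes
    computed by the scheme, whose neighbours are again grid nodes, and at those
    prescribed by the data. *)
Lemma grid_node_ind (M : nat) (P : nat -> nat -> Prop) :
  (forall i j, interior_node M i j -> (i <= M)%N -> (j <= M)%N ->
     (i.+1 <= M)%N -> (j.+1 <= M)%N -> (i.-1 <= M)%N -> (j.-1 <= M)%N ->
     P i j) ->
  (forall i j, boundary_node M i j -> P i j) ->
  forall i j, (i <= M)%N -> (j <= M)%N -> P i j.
Proof.
move=> Pint Pbd i j iM jM; case: (boolP (interior_node M i j)) => ij; last first.
  by apply: Pbd; rewrite /boundary_node iM jM.
move: (ij) => /andP[/andP[_ iM'] /andP[_ jM']].
by apply: Pint => //; exact: leq_trans (leq_pred _) _.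
Qed.

Lemma maccormack_max_bound {R : realType} {T a K B : R} {f : R -> R}
    {u0 : R * R -> R} {phi : R * R * R -> R} {N M : nat}
    {u : nat -> nat -> nat -> R} :
  0 < T -> 0 < a -> 0 <= K -> (0 < N)%N -> (0 < M)%N ->
  (forall x, `|f x| <= K * (1 + `|x|)) ->
  2 * a * tstep T N / mesh M ^+ 2 <= 1 ->
  (forall p, cl_Omega p -> `|u0 p| <= B) ->
  (forall p t, bd_Omega p -> 0 < t <= T -> `|phi (p, t)| <= B) ->
  maccormack_solution T a f u0 phi N M u ->
  forall n, (n <= N)%N -> forall i j, (i <= M)%N -> (j <= M)%N ->
  1 + `|u n i j| <= (1 + B) * ((1 + tstep T N / 2 * K) ^+ 2) ^+ n.
Proof.
move=> T_gt0 a_gt0 K_ge0 N_gt0 M_gt0 fK cfl u0B phiB.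
move=> [us [uss [u_init u_int u_bd uss_bd]]].
set k := tstep T N in cfl u_int u_bd uss_bd *.
set h := mesh M in cfl.
set g := 1 + k / 2 * K.
have N_gt0' : 0 < N%:R :> R by rewrite ltr0n.
have k_gt0 : 0 < k by rewrite divr_gt0.
have h2_gt0 : 0 < h ^+ 2 by rewrite exprn_gt0 ?invr_gt0 ?ltr0n.
have g_ge1 : 1 <= g by rewrite lerDl mulr_ge0// divr_ge0// ltW.
have g_ge0 : 0 <= g := le_trans ler01 g_ge1.
have r_ge0 : 0 <= k * a / h ^+ 2 by rewrite ltW// divr_gt0// mulr_gt0.
have r_le : 2 * (k * a / h ^+ 2) <= 1.
  by move: cfl; congr (_ <= _); ring.
have hrE : k / 2 * a / h ^+ 2 = k * a / h ^+ 2 / 2.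
  by field; move: h2_gt0; rewrite exprn_even_gt0//=.
have hr_ge0 : 0 <= k / 2 * a / h ^+ 2 by rewrite hrE; lra.
have hr_le : 2 * (k / 2 * a / h ^+ 2) <= 1 by rewrite hrE; lra.
have k2_ge0 : 0 <= k / 2 by lra.
have bd_le n i j : (n < N)%N -> boundary_node M i j ->
    1 + `|phi (gridpt M i j, n.+1%:R * k)| <= 1 + B.
  move=> nN bij; rewrite lerD2l; apply: phiB.
    exact: boundary_node_bd_Omega.
  rewrite mulr_gt0 ?ltr0n//= /k /tstep mulrCA ler_piMr ?(ltW T_gt0)//.
  by rewrite ler_pdivrMr// mul1r ler_nat.
have B_ge0 : 0 <= 1 + B.
  have := u0B _ (@gridpt_cl_Omega R M 0 0 M_gt0 (leq0n _) (leq0n _)).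
  by move=> /(le_trans (normr_ge0 _)) B_ge0; rewrite addr_ge0.
elim=> [_ i j iM jM|n IHn nN].
  by rewrite expr0 mulr1 u_init// lerD2l u0B//; exact: gridpt_cl_Omega.
have {IHn} := IHn (ltnW nN); set m := (1 + B) * _ => u_le.
have B_le_m : 1 + B <= m by rewrite ler_peMr// !exprn_ege1.
have m_ge0 : 0 <= m := le_trans B_ge0 B_le_m.
have B_le_mg : 1 + B <= m * g by rewrite (le_trans B_le_m)// ler_peMr.
have us_le : forall i j, (i <= M)%N -> (j <= M)%N -> 1 + `|us n i j| <= m * g.
  apply: grid_node_ind => [i j ij iM jM iS jS iP jP|i j bij].
    have [-> _ _] := u_int n i j nN ij.
    by apply: reaction_diffusion_sweep_le => //; apply: u_le.
  by have [-> _] := uss_bd n i j nN bij; rewrite (le_trans (bd_le n i j nN bij)).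
have uss_le : forall i j, (i <= M)%N -> (j <= M)%N -> 1 + `|uss n i j| <= m * g.
  apply: grid_node_ind => [i j ij iM jM iS jS iP jP|i j bij].
    have [_ -> _] := u_int n i j nN ij.
    rewrite -lerBrDl; apply: diffusion_sweep_le => //; rewrite lerBrDl;
      exact: us_le.
  by have [_ ->] := uss_bd n i j nN bij; rewrite (le_trans (bd_le n i j nN bij)).
have -> : (1 + B) * (g ^+ 2) ^+ n.+1 = m * g * g by rewrite exprSr /m; ring.
apply: grid_node_ind => [i j ij iM jM iS jS iP jP|i j bij].
  have [_ _ ->] := u_int n i j nN ij.
  by apply: reaction_diffusion_sweep_le => //; apply: uss_le.
rewrite u_bd// (le_trans (bd_le n i j nN bij))// (le_trans B_le_mg)// ler_peMr//.
by rewrite mulr_ge0.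
Qed.

Theorem theorem3p1 (R : realType) (T a : R) (f : R -> R) (u0 : R * R -> R)
    (phi ubar : R * R * R -> R) (Ct : R)
    (T_gt0 : 0 < T) (a_gt0 : 0 < a)
    (f_C1 : C1 f) (f_lip : lipschitz f)
    (compat : forall p, bd_Omega p -> phi (p, 0) = u0 p)
    (ubar_sol : exact_solution T a f u0 phi ubar)
    (Ct_gt0 : 0 < Ct) (ubar_reg : regularity_bound T ubar Ct) :
  exists C : R, 0 < C /\
    forall N M : nat, (0 < N)%N -> (0 < M)%N ->
    let k := tstep T N in let h := mesh M in
    2 * a * k / h ^+ 2 <= 1 ->
    forall u : nat -> nat -> nat -> R,
    maccormack_solution T a f u0 phi N M u ->
    grid_linfty_l2 N M u <= Ct + expR (C * T * \sum_(l < 4) (C * k) ^+ l).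
Proof.
have [K K_gt0 fK] := lipschitz_linear_growth f_lip.
have [B B_gt0 ubarB] := exact_solution_bounded ubar_sol.
have [_ _ ubar0 ubar_phi] := ubar_sol.
have u0B p : cl_Omega p -> `|u0 p| <= B.
  by move=> Op; rewrite -ubar0//; apply: ubarB; split => //=; rewrite lexx ltW.
have phiB p t : bd_Omega p -> 0 < t <= T -> `|phi (p, t)| <= B.
  move=> Op tT; rewrite -ubar_phi//; apply: ubarB; case: Op => Op _; split => //=.
  by case/andP: tT => /ltW -> ->.
(* This choice gives exp (C T) = (1 + B) exp (K T). *)
pose C := K + ln (1 + B) / T.
have C_gt0 : 0 < C by rewrite addr_gt0// divr_gt0// ln_gt0// ltrDl.
have expC : expR (C * T) = (1 + B) * expR (K * T).
  rewrite /C mulrDl divfK ?gt_eqF// addrC expRD lnK// posrE.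
  by rewrite addr_gt0.
exists C; split=> // N M N_gt0 M_gt0 k h cfl u u_sol.
have k_ge0 : 0 <= k by rewrite divr_ge0// ltW.
have bound_le : (1 + B) * expR (K * T) <=
    Ct + expR (C * T * \sum_(l < 4) (C * k) ^+ l).
  rewrite -expC ler_wpDl ?(ltW Ct_gt0)// ler_expR ler_peMr//.
    by rewrite mulr_ge0 ?ltW.
  rewrite big_ord_recl expr0 lerDl sumr_ge0// => l _.
  by rewrite exprn_ge0// mulr_ge0// ltW.
have bound_ge0 : 0 <= (1 + B) * expR (K * T).
  by rewrite mulr_ge0 ?expR_ge0// addr_ge0// ltW.
apply: bigmax_le => [|n _]; first exact: le_trans bound_le.
have n_le : (n <= N)%N by rewrite -ltnS.
apply: le_trans bound_le; apply: grid_l2_le => // i j iM jM.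
have := maccormack_max_bound T_gt0 a_gt0 (ltW K_gt0) N_gt0 M_gt0 fK cfl
  u0B phiB u_sol n n_le i j iM jM.
move=> u_le; apply: (@le_trans _ _ (1 + `|u n i j|)); first by rewrite lerDr.
apply: (le_trans u_le); rewrite ler_wpM2l ?addr_ge0// ?(ltW B_gt0)//.
by apply: compound_growth_le_expR => //; rewrite ltW.
Qed.
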